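(* Let $R$ be a commutative unital ring, let $A$ and $B$ be unital associative $R$-algebras and let $M$ be a nonzero $(A,B)$-bimodule that is faithful as a left $A$-module and as a right $B$-module. Let $\mathcal{T}=\mathrm{Trian}(A,M,B)$ be the associated triangular algebra and $\sigma$ an automorphism of $\mathcal{T}$. Assume that $A$ and $B$ have only trivial idempotents, and let $f_\sigma, g_\sigma, m_\sigma, \nu_\sigma$ be the data determined by $\sigma$. Then every $\sigma$-centralizing map $\Theta$ of $\mathcal{T}$ can be written as $$\Theta\begin{pmatrix} a & m\\ & b\end{pmatrix}=\begin{pmatrix} \delta_1(a)+\delta_2(m)+\delta_3(b) & \; -m_\sigma(\mu_1(a)+\mu_2(m)+\mu_3(b))+\delta_1(1_A)m-\nu_\sigma(m)\mu_1(1_A)\\ & \mu_1(a)+\mu_2(m)+\mu_3(b)\end{pmatrix}$$ for all $a\in A$, $m\in M$, $b\in B$, where $\delta_1:A\to A$, $\delta_2:M\to \mathrm{Z}_{f_\sigma}(A)$, $\delta_3:B\to A$, $\mu_1:A\to B$, $\mu_2:M\to \mathrm{Z}_{g_\sigma}(B)$, $\mu_3:B\to B$ are linear maps which satisfy the following conditions for all $a\in A$, $m\in M$, $b\in B$: (i) $\delta_1$ is an $f_\sigma$-commuting map of $A$; (ii) $\mu_3$ is a $g_\sigma$-commuting map of $B$; (iii) $\delta_1(a)m-\nu_\sigma(m)\mu_1(a)=f_\sigma(a)\big(\delta_1(1_A)m-\nu_\sigma(m)\mu_1(1_A)\big)$; (iv) $\nu_\sigma(m)\mu_3(b)-\delta_3(b)m=\big(\nu_\sigma(m)\mu_3(1_B)-\delta_3(1_B)m\big)b$;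 (v) $\delta_2(m)m=\nu_\sigma(m)\mu_2(m)$; (vi) $\delta_1(1_A)m-\nu_\sigma(m)\mu_1(1_A)=\nu_\sigma(m)\mu_3(1_B)-\delta_3(1_B)m$; (vii) $[a,\delta_3(b)]_{f_\sigma}\in \mathrm{Z}(A)$; (viii) $[b,\mu_1(a)]_{g_\sigma}\in \mathrm{Z}(B)$.
   Context: The triangular algebra $\mathrm{Trian}(A,M,B)$ is the set of all matrices $\begin{pmatrix} a & m\\ & b\end{pmatrix}$ with $a\in A$, $m\in M$, $b\in B$, which is a unital associative $R$-algebra under the usual matrix operations. All automorphisms are $R$-algebra automorphisms and linear means $R$-linear. $\mathrm{Z}(\cdot)$ denotes the center; $1_A,1_B$ are the units. An algebra has only trivial idempotents if $0$ and $1$ are its only idempotents. Data determined by $\sigma$ (known result): when $A$ and $B$ have only trivial idempotents, every automorphism $\sigma$ of $\mathcal{T}=\mathrm{Trian}(A,M,B)$ has the form $$\sigma\begin{pmatrix} a & m\\ & b\end{pmatrix}=\begin{pmatrix} f_\sigma(a) & f_\sigma(a)m_\sigma-m_\sigma g_\sigma(b)+\nu_\sigma(m)\\ & g_\sigma(b)\end{pmatrix},$$ where $f_\sigma$, $g_\sigma$ are automorphisms of $A$, $B$ respectively, $m_\sigma\in M$, and $\nu_\sigma:M\to M$ is a linear bijection with $\nu_\sigma(am)=f_\sigma(a)\nu_\sigma(m)$ and $\nu_\sigma(mb)=\nu_\sigma(m)g_\sigma(b)$ for all $a\in A$, $b\in B$, $m\in M$. For an algebra $\mathcal{A}$ and an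 automorphism $\varphi$ of $\mathcal{A}$, put $[x,y]_\varphi=\varphi(x)y-yx$. A linear map $\Theta:\mathcal{A}\to\mathcal{A}$ is $\varphi$-commuting if $[x,\Theta(x)]_\varphi=0$ for all $x\in\mathcal{A}$, and $\varphi$-centralizing if $[x,\Theta(x)]_\varphi\in \mathrm{Z}(\mathcal{A})$ for all $x\in\mathcal{A}$. The $\varphi$-center of $\mathcal{A}$ is $\mathrm{Z}_\varphi(\mathcal{A})=\{\lambda\in\mathcal{A}: \varphi(x)\lambda=\lambda x \text{ for all } x\in\mathcal{A}\}$. *)

(* Defs.v *)
From HB Require Import structures.
From mathcomp Require Import all_boot all_algebra.

Set Implicit Arguments.
Unset Strict Implicit.
Unset Printing Implicit Defensive.

Import GRing.Theory.
Local Open Scope ring_scope.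

Reserved Notation "a *> m" (at level 40, m at next level).
Reserved Notation "m <* b" (at level 40, left associativity).

(* The remaining compatibilities with the [R]-action, [a *> (r *: m) =
   r *: (a *> m)] and [(r *: m) <* b = r *: (m <* b)], follow from these axioms
   since [A] and [B] are [R]-algebras (lemmas [lactZr] and [ractZl]). *)
HB.mixin Record isBimodule (R : comPzRingType) (A B : algType R) M
    of GRing.Lmodule R M := {
  lact : A -> M -> M;
  ract : M -> B -> M;
  lact1 : forall m, lact 1 m = m;
  lactA : forall a a' m, lact (a * a') m = lact a (lact a' m);
  lactDl : forall a a' m, lact (a + a') m = lact a m + lact a' m;
  lactDr : forall a m m', lact a (m + m') = lact a m + lact a m';
  ract1 : forall m, ract m 1 = m;
  ractA : forall m b b', ract m (b * b') = ract (ract m b) b';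
  ractDl : forall m m' b, ract (m + m') b = ract m b + ract m' b;
  ractDr : forall m b b', ract m (b + b') = ract m b + ract m b';
  lractA : forall a m b, ract (lact a m) b = lact a (ract m b);
  lactZl : forall (r : R) a m, lact (r *: a) m = r *: lact a m;
  ractZr : forall (r : R) m b, ract m (r *: b) = r *: ract m b
}.

#[short(type="bimodType")]
HB.structure Definition Bimodule (R : comPzRingType) (A B : algType R) :=
  { M of GRing.Lmodule R M & isBimodule R A B M }.

Notation "a *> m" := (lact a m) : ring_scope.
Notation "m <* b" := (ract m b) : ring_scope.

Section BimoduleTheory.
Variables (R : comPzRingType) (A B : algType R) (M : bimodType A B).
Implicit Types (a : A) (b : B) (m : M).

Definition faithful_left := forall a, (forall m, a *> m = 0) -> a = 0.
Definition faithful_right := forall b, (forall m, m <* b = 0) -> b = 0.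

Lemma lact0r a : a *> (0 : M) = 0.
Proof. by apply: (addrI (a *> (0 : M))); rewrite -lactDr !addr0. Qed.

Lemma lact0l m : (0 : A) *> m = 0.
Proof. by apply: (addrI ((0 : A) *> m)); rewrite -lactDl !addr0. Qed.

Lemma ract0l b : (0 : M) <* b = 0.
Proof. by apply: (addrI ((0 : M) <* b)); rewrite -ractDl !addr0. Qed.

Lemma ract0r m : m <* (0 : B) = 0.
Proof. by apply: (addrI (m <* (0 : B))); rewrite -ractDr !addr0. Qed.

Lemma lactZr (r : R) a m : a *> (r *: m) = r *: (a *> m).
Proof.
by rewrite -{1}[m](@lact1 R A B M) -lactZl -lactA -scalerAr mulr1 lactZl.
Qed.

Lemma ractZl (r : R) m b : (r *: m) <* b = r *: (m <* b).
Proof.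
by rewrite -{1}[m](@ract1 R A B M) -ractZr -ractA -scalerAl mul1r ractZr.
Qed.

End BimoduleTheory.

Arguments faithful_left {R A B} M.
Arguments faithful_right {R A B} M.

Definition trian (R : comPzRingType) (A B : algType R) (M : bimodType A B) :
  Type := (A * M * B)%type.

Section Triangular.
Variables (R : comPzRingType) (A B : algType R) (M : bimodType A B).
Local Notation T := (trian M).

HB.instance Definition _ := GRing.Lmodule.copy T (A * M * B)%type.

Definition Trian (a : A) (m : M) (b : B) : T := (a, m, b).
Definition tr11 (x : T) : A := x.1.1.
Definition tr12 (x : T) : M := x.1.2.
Definition tr22 (x : T) : B := x.2.

Definition trian_one : T := Trian 1 0 1.
Definition trian_mul (x y : T) : T :=
  Trian (tr11 x * tr11 y)
        (tr11 x *> tr12 y + tr12 x <* tr22 y)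
        (tr22 x * tr22 y).

Lemma trian_mulA : associative trian_mul.
Proof.
move=> [[a m] b] [[a' m'] b'] [[a2 m2] b2].
rewrite /trian_mul /Trian /tr11 /tr12 /tr22 /= !mulrA; congr (_, _, _).
by rewrite lactDr ractDl lactA ractA lractA addrA.
Qed.

Lemma trian_mul1r : left_id trian_one trian_mul.
Proof.
move=> [[a m] b]; rewrite /trian_mul /Trian /tr11 /tr12 /tr22 /=.
by rewrite !mul1r lact1 ract0l addr0.
Qed.

Lemma trian_mulr1 : right_id trian_one trian_mul.
Proof.
move=> [[a m] b]; rewrite /trian_mul /Trian /tr11 /tr12 /tr22 /=.
by rewrite !mulr1 ract1 lact0r add0r.
Qed.

Lemma trian_mulDl : left_distributive trian_mul +%R.
Proof.
move=> [[a m] b] [[a' m'] b'] [[a2 m2] b2].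
rewrite /trian_mul /Trian /tr11 /tr12 /tr22 /=.
by congr (_, _, _); rewrite ?mulrDl // lactDl ractDl addrACA.
Qed.

Lemma trian_mulDr : right_distributive trian_mul +%R.
Proof.
move=> [[a m] b] [[a' m'] b'] [[a2 m2] b2].
rewrite /trian_mul /Trian /tr11 /tr12 /tr22 /=.
by congr (_, _, _); rewrite ?mulrDr // lactDr ractDr addrACA.
Qed.

Lemma trian_one_neq0 : trian_one != 0.
Proof. by apply/eqP => /(congr1 tr11) /= /eqP; rewrite (negPf (oner_neq0 _)). Qed.

HB.instance Definition _ := GRing.Zmodule_isNzRing.Build T
  trian_mulA trian_mul1r trian_mulr1 trian_mulDl trian_mulDr trian_one_neq0.

Lemma trian_scalerAl (r : R) (x y : T) : r *: (x * y) = (r *: x) * y.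
Proof.
case: x y => [[a m] b] [[a' m'] b'].
by congr (_, _, _); rewrite /= -?scalerAl // scalerDr lactZl ractZl.
Qed.

Lemma trian_scalerAr (r : R) (x y : T) : r *: (x * y) = x * (r *: y).
Proof.
case: x y => [[a m] b] [[a' m'] b'].
by congr (_, _, _); rewrite /= -?scalerAr // scalerDr lactZr ractZr.
Qed.

HB.instance Definition _ :=
  GRing.Lmodule_isLalgebra.Build R T trian_scalerAl.
HB.instance Definition _ :=
  GRing.LSemiAlgebra_isSemiAlgebra.Build R T trian_scalerAr.

End Triangular.

Section TwistedMaps.
Variable A : pzRingType.
Implicit Types (phi Theta : A -> A) (x y z : A).

Definition trivial_idempotents := forall e : A, e * e = e -> e = 0 \/ e = 1.

Definition in_center z := forall x, z * x = x * z.

Definition phi_bracket phi x y := phi x * y - y * x.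

Definition in_phi_center phi z := forall x, phi x * z = z * x.

Definition phi_commuting phi Theta :=
  forall x, phi_bracket phi x (Theta x) = 0.

Definition phi_centralizing phi Theta :=
  forall x, in_center (phi_bracket phi x (Theta x)).

End TwistedMaps.

Arguments trivial_idempotents A : clear implicits.

Record trian_aut_data (R : comPzRingType) (A B : algType R)
    (M : bimodType A B) (sigma : {lrmorphism trian M -> trian M})
    (f : {lrmorphism A -> A}) (g : {lrmorphism B -> B})
    (ms : M) (nu : {linear M -> M}) : Prop := TrianAutData {
  aut_data_f : bijective f;
  aut_data_g : bijective g;
  aut_data_nu : bijective nu;
  aut_data_nul : forall (a : A) (m : M), nu (a *> m) = f a *> nu m;
  aut_data_nur : forall (m : M) (b : B), nu (m <* b) = nu m <* g b;
  aut_data_sigma : forall (a : A) (m : M) (b : B),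
    sigma (Trian a m b) =
      Trian (f a) (f a *> ms - ms <* g b + nu m) (g b)
}.

(* Existence and uniqueness of the data attached to an automorphism, so that
   quantifying over [f], [g], [ms] and [nu] amounts to naming these data. *)
Section AutData.
Variables (R : comPzRingType) (A B : algType R) (M : bimodType A B).
Variable sigma : {lrmorphism trian M -> trian M}.

Lemma Trian_eta (x : trian M) : x = Trian (tr11 x) (tr12 x) (tr22 x).
Proof. by case: x => [[]]. Qed.

Lemma Trian_eqP (a a' : A) (m m' : M) (b b' : B) :
  Trian a m b = Trian a' m' b' -> [/\ a = a', m = m' & b = b'].
Proof. by case=> -> -> ->. Qed.

Lemma TrianM (a a' : A) (m m' : M) (b b' : B) :
  Trian a m b * Trian a' m' b' =
    Trian (a * a') (a *> m' + m <* b') (b * b').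
Proof. by []. Qed.

Lemma TrianD (a a' : A) (m m' : M) (b b' : B) :
  Trian a m b + Trian a' m' b' = Trian (a + a') (m + m') (b + b').
Proof. by []. Qed.

Lemma TrianZ (r : R) (a : A) (m : M) (b : B) :
  r *: Trian a m b = Trian (r *: a) (r *: m) (r *: b).
Proof. by []. Qed.

Lemma trian_aut_data_uniq (f f' : {lrmorphism A -> A})
    (g g' : {lrmorphism B -> B}) (ms ms' : M) (nu nu' : {linear M -> M}) :
  trian_aut_data sigma f g ms nu -> trian_aut_data sigma f' g' ms' nu' ->
  [/\ f =1 f', g =1 g', ms = ms' & nu =1 nu'].
Proof.
move=> [_ _ _ _ _ E] [_ _ _ _ _ E'].
have {E'}E a m b := Trian_eqP (etrans (esym (E a m b)) (E' a m b)).
split=> [a | b | | m].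
- by case: (E a 0 0).
- by case: (E 0 0 b).
- by case: (E 1 0 0) => _; rewrite !rmorph1 !raddf0 !lact1 !ract0r !subr0 !addr0.
- by case: (E 0 m 0) => _; rewrite !raddf0 !lact0l !ract0r !subr0 !add0r.
Qed.

Hypotheses (M_neq0 : exists m : M, m <> 0) (sigma_bij : bijective sigma).
Hypotheses (A_idem : trivial_idempotents A) (B_idem : trivial_idempotents B).

Let e : trian M := Trian 1 0 0.

Lemma trian_aut_idem : exists ms, sigma e = Trian 1 ms 0.
Proof.
have [tau sK tK] := sigma_bij; have [m0 m0N] := M_neq0.
have ee : sigma e * sigma e = sigma e.
  by rewrite -rmorphM TrianM !mulr1 !mulr0 lact0r ract0l addr0.
have se0 : sigma e <> 0.
  move=> /(congr1 tau); rewrite sK -(raddf0 sigma) sK => /(congr1 (@tr11 _ _ _ _)).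
  by move/eqP; rewrite (negPf (oner_neq0 _)).
have se1 : sigma e <> 1.
  move=> /(congr1 tau); rewrite sK -(rmorph1 sigma) sK => /(congr1 (@tr22 _ _ _ _)).
  by move/eqP; rewrite eq_sym (negPf (oner_neq0 _)).
have se01 x : (1 - sigma e) * x * sigma e = 0.
  rewrite -[x]tK -(rmorph1 sigma) -rmorphB -!rmorphM -[RHS](raddf0 sigma) /=.
  congr (sigma _).
  rewrite [tau x]Trian_eta; set a := tr11 _; set m := tr12 _; set b := tr22 _.
  have -> : 1 - e = Trian 0 0 1.
    by apply: (addIr e); rewrite subrK TrianD !add0r addr0.
  by rewrite !TrianM !mul0r mulr0 lact0r ract0r addr0.
move: ee se0 se1 se01; rewrite [sigma e]Trian_eta.
set p := tr11 _; set q := tr12 _; set r := tr22 _.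
rewrite TrianM => /Trian_eqP[/A_idem pE qE /B_idem rE] se0 se1 se01.
move: qE se0 se1 se01; case: pE => ->; case: rE => ->.
- by rewrite lact0l ract0r addr0 => <- [].
- move=> _ _ _ /(_ (Trian 0 m0 0)).
  have -> : 1 - Trian 0 q 1 = Trian 1 (- q) 0 :> trian M.
    apply: (addIr (Trian 0 q 1)).
    by rewrite subrK TrianD addr0 add0r addNr.
  rewrite !TrianM !mulr0 mul0r ract0r addr0 lact1 lact0l add0r ract1.
  by move=> /(congr1 (@tr12 _ _ _ _)).
- by exists q.
- rewrite lact1 ract1 => /(canRL (addrK _)); rewrite subrr => -> _ [].
  by [].
Qed.

Let F (a : A) : A := tr11 (sigma (Trian a 0 0)).
Let G (b : B) : B := tr22 (sigma (Trian 0 0 b)).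
Let N (m : M) : M := tr12 (sigma (Trian 0 m 0)).

Lemma trian_aut_data_ex :
  exists (f : {lrmorphism A -> A}) (g : {lrmorphism B -> B}) (ms : M)
         (nu : {linear M -> M}), trian_aut_data sigma f g ms nu.
Proof.
have [ms se] := trian_aut_idem; have [tau sK tK] := sigma_bij.
have sF a : sigma (Trian a 0 0) = Trian (F a) (F a *> ms) 0.
  have : sigma e * sigma (Trian a 0 0) * sigma e = sigma (Trian a 0 0).
    rewrite -!rmorphM !TrianM !mulr0 mul1r mulr1.
    by rewrite !lact0r !ract0r !addr0.
  rewrite /F se [sigma (Trian a 0 0)]Trian_eta /=.
  rewrite !TrianM !mulr0 mul1r mulr1 ract0r addr0 => /Trian_eqP[_ <- <-].
  by rewrite /tr11.
have sG b : sigma (Trian 0 0 b) = Trian 0 (- (ms <* G b)) (G b).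
  have X1 : sigma e * sigma (Trian 0 0 b) = 0.
    rewrite -!rmorphM !TrianM mulr0 mul0r lact0r ract0l addr0.
    exact: raddf0.
  have X2 : sigma (Trian 0 0 b) * sigma e = 0.
    rewrite -!rmorphM !TrianM mulr0 mul0r lact0r ract0r addr0.
    exact: raddf0.
  move: X1 X2; rewrite /G se [sigma (Trian 0 0 b)]Trian_eta.
  set p := tr11 _; set q := tr12 _; set r := tr22 _.
  rewrite !TrianM lact1 mulr1 => /Trian_eqP[_ qE _] /Trian_eqP[-> _ _].
  by rewrite -[q](addrK (ms <* r)) qE sub0r.
have sN m : sigma (Trian 0 m 0) = Trian 0 (N m) 0.
  have X1 : sigma e * sigma (Trian 0 m 0) = sigma (Trian 0 m 0).
    by rewrite -!rmorphM !TrianM !mulr0 lact1 ract0l addr0.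
  have X2 : sigma (Trian 0 m 0) * sigma e = 0.
    rewrite -!rmorphM !TrianM mulr0 mul0r lact0l ract0r addr0.
    exact: raddf0.
  move: X1 X2; rewrite /N se [sigma (Trian 0 m 0)]Trian_eta.
  set p := tr11 _; set q := tr12 _; set r := tr22 _.
  rewrite !TrianM mul0r mulr1 => /Trian_eqP[_ _ <-] /Trian_eqP[-> _ _].
  by [].
have sE a m b : sigma (Trian a m b) =
    Trian (F a) (F a *> ms - ms <* G b + N m) (G b).
  have -> : Trian a m b = Trian a 0 0 + Trian 0 0 b + Trian 0 m 0 :> trian M.
    by rewrite !TrianD !addr0 !add0r.
  by rewrite !raddfD /= sF sG sN !TrianD !addr0 !add0r.
have F_lin : linear F.
  move=> r a a'; rewrite /F.
  have -> : Trian (r *: a + a') 0 0 = r *: Trian a 0 0 + Trian a' 0 0 :> trian M.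
    by rewrite TrianZ TrianD !scaler0 !addr0.
  by rewrite linearP.
have G_lin : linear G.
  move=> r b b'; rewrite /G.
  have -> : Trian 0 0 (r *: b + b') = r *: Trian 0 0 b + Trian 0 0 b' :> trian M.
    by rewrite TrianZ TrianD !scaler0 !addr0.
  by rewrite linearP.
have N_lin : linear N.
  move=> r m m'; rewrite /N.
  have -> : Trian 0 (r *: m + m') 0 = r *: Trian 0 m 0 + Trian 0 m' 0 :> trian M.
    by rewrite TrianZ TrianD !scaler0 !addr0.
  by rewrite linearP.
have F_mul : monoid_morphism F.
  split; first by rewrite /F se.
  move=> a a'; rewrite /F.
  have -> : Trian (a * a') 0 0 = Trian a 0 0 * Trian a' 0 0 :> trian M.
    by rewrite TrianM lact0r ract0l mulr0 addr0.
  by rewrite rmorphM.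
have G_mul : monoid_morphism G.
  split.
    have : sigma (Trian 1 0 1) = Trian 1 0 1 by exact: rmorph1.
    by rewrite sE => /Trian_eqP[].
  move=> b b'; rewrite /G.
  have -> : Trian 0 0 (b * b') = Trian 0 0 b * Trian 0 0 b' :> trian M.
    by rewrite TrianM lact0r ract0l mulr0 addr0.
  by rewrite rmorphM.
pose FL := GRing.isLinear.Build R A A *:%R F F_lin.
pose FM := GRing.isMonoidMorphism.Build A A F F_mul.
pose GL := GRing.isLinear.Build R B B *:%R G G_lin.
pose GM := GRing.isMonoidMorphism.Build B B G G_mul.
pose NL := GRing.isLinear.Build R M M *:%R N N_lin.
pose f : {lrmorphism A -> A} := HB.pack F FL FM.
pose g : {lrmorphism B -> B} := HB.pack G GL GM.
pose nu : {linear M -> M} := HB.pack N NL.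
exists f, g, ms, nu; split=> /=.
- exists (fun a => tr11 (tau (Trian a (a *> ms) 0))) => a.
    by rewrite -sF sK.
  by have := tK (Trian a (a *> ms) 0); rewrite [tau _]Trian_eta sE => /Trian_eqP[].
- exists (fun b => tr22 (tau (Trian 0 (- (ms <* b)) b))) => b.
    by rewrite -sG sK.
  by have := tK (Trian 0 (- (ms <* b)) b); rewrite [tau _]Trian_eta sE => /Trian_eqP[].
- exists (fun m => tr12 (tau (Trian 0 m 0))) => m; first by rewrite -sN sK.
  have := tK (Trian 0 m 0); rewrite [tau _]Trian_eta sE => /Trian_eqP[Ea + Eb].
  by rewrite Ea Eb lact0l ract0r subrr add0r.
- move=> a m; rewrite {1}/N.
  have -> : Trian 0 (a *> m) 0 = Trian a 0 0 * Trian 0 m 0 :> trian M.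
    by rewrite TrianM ract0r !mulr0 addr0.
  by rewrite rmorphM /= sF sN TrianM ract0r addr0.
- move=> m b; rewrite {1}/N.
  have -> : Trian 0 (m <* b) 0 = Trian 0 m 0 * Trian 0 0 b :> trian M.
    by rewrite TrianM lact0l !mul0r add0r.
  by rewrite rmorphM /= sG sN TrianM lact0l add0r.
- exact: sE.
Qed.

End AutData.

(* Main.v *)
(* For x = (a, m, b), centrality of [x, Theta x]_sigma says that its off-diagonal
   entry vanishes and that its diagonal entries D = [a, P]_f and C = [b, S]_g
   are central with D m' = m' C for all m'. If a = 0 or b = 0, one of D, C is
   zero, hence so is the other by faithfulness. The substitution
   Q' = Q + m_sigma S removes m_sigma from the off-diagonal equation whenever
   C = 0; evaluating it at (a, m, 0) and (0, m, b), and putting a = 1 or b = 1,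
   shows that Q' depends on m alone and yields all the conditions but (vii) and
   (viii), which are the centrality of D and C at (a, 0, b). *)
Require Import Defs.
From HB Require Import structures.
From mathcomp Require Import all_boot all_algebra.

Set Implicit Arguments.
Unset Strict Implicit.
Unset Printing Implicit Defensive.

Import GRing.Theory.
Local Open Scope ring_scope.


Section TriangularLinear.
Variables (R : comPzRingType) (A B : algType R) (M : bimodType A B).

(** The injections and the diagonal projections carry linear structures so that the six maps of the
    theorem, built as compositions with [Theta], are linear by inference. *)
Definition trian_inl (a : A) : trian M := Trian a 0 0.
Definition trian_inm (m : M) : trian M := Trian 0 m 0.
Definition trian_inr (b : B) : trian M := Trian 0 0 b.

Lemma trian_inl_is_linear : linear trian_inl.
Proof.
by move=> r a a'; rewrite /trian_inl TrianZ TrianD !scaler0 !addr0.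
Qed.
HB.instance Definition _ :=
  GRing.isLinear.Build R A (trian M) *:%R trian_inl trian_inl_is_linear.

Lemma trian_inm_is_linear : linear trian_inm.
Proof.
by move=> r m m'; rewrite /trian_inm TrianZ TrianD !scaler0 !addr0.
Qed.
HB.instance Definition _ :=
  GRing.isLinear.Build R M (trian M) *:%R trian_inm trian_inm_is_linear.

Lemma trian_inr_is_linear : linear trian_inr.
Proof.
by move=> r b b'; rewrite /trian_inr TrianZ TrianD !scaler0 !addr0.
Qed.
HB.instance Definition _ :=
  GRing.isLinear.Build R B (trian M) *:%R trian_inr trian_inr_is_linear.

Lemma tr11_is_linear : linear (@tr11 R A B M).
Proof. by []. Qed.
HB.instance Definition _ :=
  GRing.isLinear.Build R (trian M) A *:%R (@tr11 R A B M) tr11_is_linear.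

Lemma tr22_is_linear : linear (@tr22 R A B M).
Proof. by []. Qed.
HB.instance Definition _ :=
  GRing.isLinear.Build R (trian M) B *:%R (@tr22 R A B M) tr22_is_linear.

Lemma TrianB (a a' : A) (m m' : M) (b b' : B) :
  Trian a m b - Trian a' m' b' = Trian (a - a') (m - m') (b - b').
Proof. by []. Qed.

Lemma trian_decomp (a : A) (m : M) (b : B) :
  Trian a m b = trian_inl a + trian_inm m + trian_inr b.
Proof. by rewrite !TrianD !addr0 !add0r. Qed.

(** Commuting with elements of the two diagonal corners centralizes [p] and [r], the idempotent
    [Trian 1 0 0] kills [q], and [Trian 0 m 0] links [p] to [r]. *)
Lemma in_center_Trian (p : A) (q : M) (r : B) :
  in_center (Trian p q r) ->
  [/\ in_center p, q = 0, in_center r & forall m : M, p *> m = m <* r].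
Proof.
move=> zC; split=> [a | | b | m].
- by have [] := Trian_eqP (zC (Trian a 0 0)).
- have [_ + _] := Trian_eqP (zC (Trian 1 0 0)).
  by rewrite lact0r ract0r addr0 lact1 ract0l addr0.
- by have [] := Trian_eqP (zC (Trian 0 0 b)).
- have [_ + _] := Trian_eqP (zC (Trian 0 m 0)).
  by rewrite ract0r addr0 lact0l add0r.
Qed.

End TriangularLinear.

Lemma phi_bracket0 (A : pzRingType) (phi : {additive A -> A}) (y : A) :
  phi_bracket phi 0 y = 0.
Proof. by rewrite /phi_bracket raddf0 mul0r mulr0 subrr. Qed.

Theorem theorem3p1 (R : comPzRingType) (A B : algType R) (M : bimodType A B)
    (M_neq0 : exists m : M, m <> 0)
    (M_faithful_left : faithful_left M) (M_faithful_right : faithful_right M)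
    (A_idem : trivial_idempotents A) (B_idem : trivial_idempotents B)
    (sigma : {lrmorphism trian M -> trian M}) (sigma_bij : bijective sigma)
    (f : {lrmorphism A -> A}) (g : {lrmorphism B -> B})
    (ms : M) (nu : {linear M -> M})
    (sigma_data : trian_aut_data sigma f g ms nu)
    (Theta : {linear trian M -> trian M})
    (Theta_centralizing : phi_centralizing sigma Theta) :
  exists (delta1 : {linear A -> A}) (delta2 : {linear M -> A})
         (delta3 : {linear B -> A}) (mu1 : {linear A -> B})
         (mu2 : {linear M -> B}) (mu3 : {linear B -> B}),
    (forall (a : A) (m : M) (b : B),
       Theta (Trian a m b) =
         Trian (delta1 a + delta2 m + delta3 b)
               (- (ms <* (mu1 a + mu2 m + mu3 b))
                + delta1 1 *> m - nu m <* mu1 1)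
               (mu1 a + mu2 m + mu3 b))
    /\ (forall m : M, in_phi_center f (delta2 m))
    /\ (forall m : M, in_phi_center g (mu2 m))
    /\ phi_commuting f delta1
    /\ phi_commuting g mu3
    /\ (forall (a : A) (m : M),
          delta1 a *> m - nu m <* mu1 a
          = f a *> (delta1 1 *> m - nu m <* mu1 1))
    /\ (forall (m : M) (b : B),
          nu m <* mu3 b - delta3 b *> m
          = (nu m <* mu3 1 - delta3 1 *> m) <* b)
    /\ (forall m : M, delta2 m *> m = nu m <* mu2 m)
    /\ (forall m : M,
          delta1 1 *> m - nu m <* mu1 1 = nu m <* mu3 1 - delta3 1 *> m)
    /\ (forall (a : A) (b : B), in_center (phi_bracket f a (delta3 b)))
    /\ (forall (a : A) (b : B), in_center (phi_bracket g b (mu1 a))).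
Proof.
have [_ _ _ _ _ sE] := sigma_data.
pose P x := tr11 (Theta x); pose S x := tr22 (Theta x).
(* This [Q] is the shifted entry, written Q' in the outline above. *)
pose Q x := tr12 (Theta x) + ms <* S x.
have PD x y : P (x + y) = P x + P y by rewrite /P !raddfD.
have SD x y : S (x + y) = S x + S y by rewrite /S !raddfD.
have QD x y : Q (x + y) = Q x + Q y.
  by rewrite /Q SD ractDr raddfD addrACA.
(* In the last equation the two [ms] terms differ by [ms <* phi_bracket g b (S x)], so they cancel
   once that bracket vanishes. *)
have key a m b : let x := Trian a m b in
    [/\ in_center (phi_bracket f a (P x)), in_center (phi_bracket g b (S x)),
        forall m' : M, phi_bracket f a (P x) *> m' = m' <* phi_bracket g b (S x)
      & f a *> Q x + nu m <* S x + ms <* (S x * b) =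
        P x *> m + Q x <* b + ms <* (g b * S x)].
  move=> x; have := Theta_centralizing x.
  have -> : phi_bracket sigma x (Theta x) =
      Trian (f a) (f a *> ms - ms <* g b + nu m) (g b)
        * Trian (P x) (tr12 (Theta x)) (S x)
      - Trian (P x) (tr12 (Theta x)) (S x) * Trian a m b.
    by rewrite -sE -Trian_eta.
  rewrite !TrianM TrianB.
  case/in_center_Trian=> Pc /eqP + Sc PS; rewrite subr_eq0 => /eqP qE.
  split=> [|||]; [exact: Pc | exact: Sc | exact: PS |].
  rewrite /Q lactDr (ractDl _ _ b) -[ms <* S x <* b]ractA.
  rewrite [P x *> m + _]addrA -qE [RHS]addrAC; congr (_ + _).
  rewrite -[LHS]addrA -[RHS]addrA; congr (_ + _); rewrite ractA -ractDl addrAC subrK.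
  by rewrite ractDl -lractA.
have faithful0l a : (forall m : M, a *> m = m <* (0 : B)) -> a = 0.
  by move=> aM; apply: M_faithful_left => m; rewrite aM ract0r.
have faithful0r b : (forall m : M, (0 : A) *> m = m <* b) -> b = 0.
  by move=> Mb; apply: M_faithful_right => m; rewrite -Mb lact0l.
have left0 a m : let x := Trian a m 0 in
    f a * P x = P x * a /\ f a *> Q x + nu m <* S x = P x *> m.
  move=> x; have [_ _ + E] := key a m 0; rewrite phi_bracket0 -/x.
  move=> /faithful0l/subr0_eq; split=> //; move: E.
  by rewrite raddf0 mulr0 mul0r !ract0r !addr0.
have right0 m b : let x := Trian 0 m b in
    g b * S x = S x * b /\ nu m <* S x = P x *> m + Q x <* b.
  move=> x; have [_ _ + E] := key 0 m b; rewrite phi_bracket0 -/x.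
  move=> /faithful0r/subr0_eq gS; split=> //; move: E.
  by rewrite -/x gS raddf0 lact0l add0r => /addIr.
pose d1 : {linear A -> A} := @tr11 R A B M \o Theta \o @trian_inl R A B M.
pose d2 : {linear M -> A} := @tr11 R A B M \o Theta \o @trian_inm R A B M.
pose d3 : {linear B -> A} := @tr11 R A B M \o Theta \o @trian_inr R A B M.
pose u1 : {linear A -> B} := @tr22 R A B M \o Theta \o @trian_inl R A B M.
pose u2 : {linear M -> B} := @tr22 R A B M \o Theta \o @trian_inm R A B M.
pose u3 : {linear B -> B} := @tr22 R A B M \o Theta \o @trian_inr R A B M.
have PE a m b : P (Trian a m b) = d1 a + d2 m + d3 b.
  by rewrite trian_decomp !PD.
have SE a m b : S (Trian a m b) = u1 a + u2 m + u3 b.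
  by rewrite trian_decomp !SD.
pose q m := Q (Trian 0 m 0).
(* The relation [E] is quadratic in its argument. Comparing it at [a + 1] and at [a], with the value
   of [Q] at [Trian 1 0 0] known to be zero, frees [Q] from the factor [f a]. *)
have Ql0 a : Q (Trian a 0 0) = 0.
  have E a' : f a' *> Q (Trian a' 0 0) = 0.
    by have [_] := left0 a' 0; rewrite raddf0 ract0l lact0r addr0.
  have Q1 : Q (Trian 1 0 0) = 0.
    by have := E 1; rewrite rmorph1 lact1.
  have := E (a + 1).
  have -> : Trian (a + 1) 0 0 = Trian a 0 0 + Trian 1 0 0 :> trian M.
    by rewrite TrianD !addr0.
  by rewrite QD Q1 addr0 rmorphD rmorph1 lactDl E add0r lact1.
have Qr0 b : Q (Trian 0 0 b) = 0.
  have E b' : Q (Trian 0 0 b') <* b' = 0.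
    by have [_] := right0 0 b'; rewrite raddf0 ract0l lact0r add0r.
  have Q1 : Q (Trian 0 0 1) = 0 by rewrite -[LHS]ract1 E.
  have := E (b + 1).
  have -> : Trian 0 0 (b + 1) = Trian 0 0 b + Trian 0 0 1 :> trian M.
    by rewrite TrianD !addr0.
  by rewrite QD Q1 addr0 ractDr E add0r ract1.
have QE a m b : Q (Trian a m b) = q m.
  by rewrite trian_decomp !QD Ql0 Qr0 add0r addr0.
have d1C a : f a * d1 a = d1 a * a by have [] := left0 a 0.
have u3C b : g b * u3 b = u3 b * b by have [] := right0 0 b.
have d2u2 m : d2 m *> m = nu m <* u2 m.
  by have [_] := left0 0 m; rewrite raddf0 lact0l add0r => ->.
(* The terms quadratic in [m], namely [d2 m *> m] and [nu m <* u2 m], sit on opposite sides and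
   cancel by [d2u2]. *)
have qd a m : f a *> q m = d1 a *> m - nu m <* u1 a.
  have [_] := left0 a m; rewrite QE PE SE !raddf0 !addr0 lactDl ractDr d2u2.
  by rewrite addrA => /addIr <-; rewrite addrK.
have qu b m : q m <* b = nu m <* u3 b - d3 b *> m.
  have [_] := right0 m b; rewrite QE PE SE !raddf0 !add0r lactDl ractDr d2u2.
  by rewrite -addrA => /addrI ->; rewrite addrAC subrr add0r.
(* [q m] is the common value of both sides of (vi), which turns (iii) and (iv) into [qd] and
   [qu]. *)
have q1d m : d1 1 *> m - nu m <* u1 1 = q m by rewrite -qd rmorph1 lact1.
have q1u m : nu m <* u3 1 - d3 1 *> m = q m by rewrite -qu ract1.
exists d1, d2, d3, u1, u2, u3; do 10?split.
- move=> a m b; rewrite -PE -SE -addrA q1d -(QE a m b) /Q.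
  by rewrite addrC addrK -Trian_eta.
(* [d1 a + d2 m] and [d1 a] satisfy the same twisted commutation with [a]; the difference leaves it
   for [d2 m] alone, with [a] and [m] independent. *)
- move=> m a; have [+ _] := left0 a m.
  by rewrite PE raddf0 addr0 mulrDr mulrDl d1C => /addrI.
- move=> m b; have [+ _] := right0 m b.
  by rewrite SE raddf0 add0r mulrDr mulrDl u3C => /addIr.
- by move=> a; rewrite /phi_bracket d1C subrr.
- by move=> b; rewrite /phi_bracket u3C subrr.
- by move=> a m; rewrite q1d qd.
- by move=> m b; rewrite q1u qu.
- exact: d2u2.
- by move=> m; rewrite q1d q1u.
(* At [Trian a 0 b] the bracket splits additively, and its [d1 a] part is zero by [d1C]. *)
- move=> a b; have [+ _ _ _] := key a 0 b.
  rewrite /phi_bracket PE raddf0 addr0 mulrDr mulrDl d1C.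
  by rewrite opprD addrACA subrr add0r.
- move=> a b; have [_ + _ _] := key a 0 b.
  rewrite /phi_bracket SE raddf0 addr0 mulrDr mulrDl u3C.
  by rewrite opprD addrACA subrr addr0.
Qed.
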